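(* Assume that $2^{<\mathfrak{c}}=\mathfrak{c}$ and that the following statement ( * ) holds: ( * ) For any coloring $k:[\mathfrak{c}]^2\to 2$, either there is a homogeneous set of size $\mathfrak{c}$ in color $0$, or there is a set $S\in[\mathfrak{c}]^{\mathfrak{c}}$ such that for every countable $A\subset S$ there is $\beta\in\mathfrak{c}$ for which $A\subset\beta$ and $k(\{\alpha,\beta\})=1$ for all $\alpha\in A$. Then for every topological space $X$ of countable spread, $|X|\le\mathfrak{c}$ if $X$ is Hausdorff, and $o(X)=\mathfrak{c}$ if $X$ is (Hausdorff and) also infinite and regular.
   Context: $\mathfrak{c}=2^{\aleph_0}$ is viewed as an initial ordinal, $2^{<\mathfrak{c}}=\sup\{2^\lambda:\lambda<\mathfrak{c}\}$, and $[\mathfrak{c}]^{\mathfrak{c}}$ is the set of subsets of $\mathfrak{c}$ of cardinality $\mathfrak{c}$. A set $H$ is homogeneous in color $0$ if $k$ is constantly $0$ on $[H]^2$. A space has countable spread if it does not contain any uncountable discrete subspace. $o(X)$ is the number of all open subsets of $X$. *)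

(* Defs.v *)
From HB Require Import structures.
From mathcomp Require Import all_boot all_order.
From mathcomp Require Import all_classical wochoice topology.

Set Implicit Arguments.
Unset Strict Implicit.
Unset Printing Implicit Defensive.

Import Order.TTheory.

Local Open Scope classical_set_scope.
Local Open Scope card_scope.

Definition card_lt (T U : Type) (A : set T) (B : set U) : Prop :=
  A #<= B /\ ~ (B #<= A).

(* An initial ordinal is represented, up to isomorphism, by a well-ordered type
   none of whose proper initial segments has the cardinality of the whole type;
   an ordinal [beta] of [C] is identified with [set alpha | alpha < beta]. *)
Definition is_initial_ordinal (d : Order.disp_t) (C : orderType d) : Prop :=
  well_order (<=%O : rel C) /\
  forall beta : C, card_lt [set alpha : C | (alpha < beta)%O] [set: C].

Definition is_continuum (d : Order.disp_t) (C : orderType d) : Prop :=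
  is_initial_ordinal C /\ [set: C] #= [set: set nat].

(* [2 ^ {< |C|} = |K|]: the cardinal of [K] is the least upper bound of the
   cardinals [2 ^ |L|] for [|L| < |C|]. *)
Definition weak_power_eq (C K : Type) : Prop :=
  (forall L : Type, card_lt [set: L] [set: C] -> [set: set L] #<= [set: K]) /\
  (forall M : Type,
    (forall L : Type, card_lt [set: L] [set: C] -> [set: set L] #<= [set: M]) ->
    [set: K] #<= [set: M]).

(* [A]^2 *)
Definition unordered_pairs (T : Type) (A : set T) : set (set T) :=
  [set s | s `<=` A /\ s #= `I_2].

(* A colouring of pairs is given as a function on all sets; only its values on
   two-element sets matter. Colour 0 is [false] and colour 1 is [true]. *)
Definition homogeneous (T : Type) (k : set T -> bool) (i : bool) (H : set T) :
    Prop :=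
  forall s, unordered_pairs H s -> k s = i.

Definition coloring_property (d : Order.disp_t) (C : orderType d) : Prop :=
  forall k : set C -> bool,
    (exists H : set C, H #= [set: C] /\ homogeneous k false H) \/
    (exists S : set C, S #= [set: C] /\
      forall A : set C, countable A -> A `<=` S ->
        exists beta : C,
          A `<=` [set alpha | (alpha < beta)%O] /\
          forall alpha, A alpha -> k [set alpha; beta] = true).

(* [set_type D] carries the topology induced by [X]. *)
Definition discrete_subspace (X : topologicalType) (D : set X) : Prop :=
  forall U : set (set_type D), open U.

Definition countable_spread (X : topologicalType) : Prop :=
  forall D : set X, discrete_subspace D -> countable D.

(* Every set is equipotent with an initial ordinal, so [is_continuum] is
   satisfiable. *)
Lemma initial_ordinal_exists (T : choiceType) :
  exists (d : Order.disp_t) (C : orderType d),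
    is_initial_ordinal C /\ [set: C] #= [set: T].
Proof.
have [R Rwo] := well_ordering_principle T.
have min (A : {pred T}) x : x \in A ->
    exists2 z, z \in A & forall y, y \in A -> R z y.
  by move=> Ax; have [|z [[zA lz] _]] := Rwo A; [exists x | exists z].
have tot : total R.
  move=> x y; have [|z] := @min (pred2 x y) x; first by rewrite !inE eqxx.
  rewrite !inE => /orP[]/eqP-> zm; apply/orP; [left|right].
    by apply: zm; rewrite !inE eqxx orbT.
  by apply: zm; rewrite !inE eqxx.
have refl x : R x x by have := tot x x; rewrite orbb.
have anti x y : R x y -> R y x -> x = y.
  move=> xy yx; have [|z [_ uz]] := Rwo (pred2 x y).
    by exists x; rewrite !inE eqxx.
  have <- : z = x.
    apply: uz; split; first by rewrite !inE eqxx.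
    by move=> w; rewrite !inE => /orP[]/eqP->.
  apply: uz; split; first by rewrite !inE eqxx orbT.
  by move=> w; rewrite !inE => /orP[]/eqP->.
have trans y x z : R x y -> R y z -> R x z.
  move=> xy yz; have [|w] := @min (pred3 x y z) x; first by rewrite !inE eqxx.
  rewrite !inE => /or3P[]/eqP-> wm.
  - by apply: wm; rewrite !inE eqxx !orbT.
  - have yx : R y x by apply: wm; rewrite !inE eqxx.
    by rewrite (anti _ _ xy yx).
  - have zx : R z x by apply: wm; rewrite !inE eqxx.
    have zy : R z y by apply: wm; rewrite !inE eqxx orbT.
    by rewrite -(anti _ _ yz zy).
pose seg b := [set a | R a b && (a != b)].
have [S ST Sseg] : exists2 S : set T, [set: T] #<= S &
    forall b, S b -> ~ ([set: T] #<= S `&` seg b).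
  have [[b0 b0P]|noseg] := pselect (exists b, [set: T] #<= seg b); last first.
    exists setT; first by rewrite card_lexx.
    by move=> b _; rewrite setTI => h; apply: noseg; exists b.
  have [|b] := @min (fun b => [set: T] #<= seg b) b0; first exact: b0P.
  move=> bP bmin; exists (seg b) => // a /andP[ab anb] h.
  have /bmin ba : [set: T] #<= seg a.
    apply: (card_le_trans h).
    by apply: subset_card_le; exact: subIsetr.
  by move/eqP: anb; apply; apply: anti => //; apply: ba.
pose RS : rel {x : T | x \in S} := relpre val R.
have RSr : reflexive RS by move=> x; exact: refl.
have RSa : antisymmetric RS.
  by move=> x y /andP[xy yx]; apply: val_inj; apply: anti.
have RSt : transitive RS by move=> y x z; exact: trans.
pose d := Order.Disp tt tt.
pose PM := Order.Le_isPOrder.Build d {x : T | x \in S} RSr RSa RSt.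
pose P : porderType d := HB.pack {x : T | x \in S} PM.
pose TM := Order.POrder_isTotal.Build d P (fun x y => tot (val x) (val y)).
pose C : orderType d := HB.pack {x : T | x \in S} PM TM.
have cardC : [set: C] #= S by exact: card_setT.
exists d, C; split; last first.
  by rewrite (card_eql cardC) card_eq_le ST andbT card_leT.
split.
  apply: antisymmetric_well_order; first exact: le_anti.
  move=> A [x Ax].
  pose A' (y : T) := `[< exists2 z : C, z \in A & val z = y >].
  have [|z] := @min A' (val x); first by apply/asboolP; exists x.
  move=> /asboolP[z' z'A <-] zm; exists z'; split => // y yA.
  by apply: zm; apply/asboolP; exists y.
move=> beta; split; first exact: card_leT.
move=> h; apply: (Sseg (val beta) (set_mem (valP beta))).
rewrite (card_le_trans ST)// -(card_le_eql cardC) (card_le_trans h)//.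
rewrite -(card_le_eql (inj_card_eq (f := val) _)).
  apply: subset_card_le => _ [x /= + <-]; rewrite lt_def => /andP[bx xb].
  split; first exact: set_mem (valP x).
  apply/andP; split; first exact: xb.
  by apply: contraNneq bx => /val_inj ->.
by move=> x y _ _; apply: val_inj.
Qed.

(* Main.v *)
Require Import Defs.
From mathcomp Require Import all_boot all_order.
From mathcomp Require Import all_classical wochoice topology.

(** Write c for the continuum, and call a set small when its cardinality is
below c. The equality [2^{<c} = c] makes c regular (a small union of small sets
is small) and gives a set of size c only c small subsets.

Let X have countable spread. Shapirovskii's lemma ([shapirovskii]) says that
whenever every point y of Y has an open neighbourhood U y, countably many y in Y
are enough for the closure of their set and their neighbourhoods together to
cover Y. Together with the colouring hypothesis it forbids two kinds of
sequences [(x_a)] of length c with open [U_a] containing [x_a]: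
- [no_right_separated]: every [x_b] with [a < b] is outside the closure of
  [U_a];
- [no_left_separated]: every [x_b] with [b < a] is outside the closure of [U_a].

In both cases a colouring is chosen whose homogeneous sets in colour 0 index
discrete subspaces, so the second alternative holds. In the right-separated case
it puts any countable piece of the sequence inside a single [U_b]; but by
Shapirovskii's lemma some countable piece has a final segment of the sequence in
its closure. In the left-separated case it puts arbitrarily late points into any
countable intersection of the [U_a]; but Shapirovskii's lemma, applied to the
complements of the closures of the [U_a], yields a countable intersection that
misses a final segment of the sequence.

If X is Hausdorff, the first fact shows that each point is the intersection of a
small family of open sets ([small_pseudocharacter]). A closing-off argument in
the style of Hajnal and Juhasz ([hausdorff_card]) then gives a set of size c
that exhausts X. If X is regular as well, the second fact shows that each closed
set is the closure of a small set ([regular_closed_small_dense]), so there are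
at most c closed sets. An infinite Hausdorff space has an infinite sequence of
disjoint nonempty open sets, hence at least c open sets. *)

Set Implicit Arguments.
Unset Strict Implicit.
Unset Printing Implicit Defensive.

Import Order.TTheory.

Local Open Scope classical_set_scope.
Local Open Scope card_scope.

(** * Comparison of cardinalities and well-founded recursion *)

(** An injection need not be given as a function: a total relation none of
whose values is shared is easier to exhibit, and needs no point in [U]. *)
Lemma card_le_rel (T U : Type) (A : set T) (B : set U) (R : T -> U -> Prop) :
  (forall a, A a -> exists2 u, B u & R a u) ->
  (forall a a' u, A a -> A a' -> R a u -> R a' u -> a = a') ->
  A #<= B.
Proof.
move=> Rtot Rinj.
have /choice[f fP] (a : A) : exists u : B, R (val a) (val u).
  have [u Bu Rau] := Rtot _ (set_mem (valP a)).
  by exists (SigSub (mem_set Bu)).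
apply/card_leP/injfunPex; exists f => // a a' _ _ faa'; apply: val_inj.
apply: (Rinj _ _ (val (f a))) => //; first exact: set_mem (valP a).
  exact: set_mem (valP a').
by rewrite faa'.
Qed.

Lemma card_le_inj (T U : Type) (A : set T) (B : set U) :
  A #<= B -> [set: U] !=set0 ->
  exists f : T -> U, (forall a, A a -> B (f a)) /\
    (forall a a', A a -> A a' -> f a = f a' -> a = a').
Proof.
move=> /card_leP[f] [u0 _].
exists (fun a => if pselect (A a) is left Aa then val (f (SigSub (mem_set Aa)))
                 else u0); split=> [a Aa|a a' Aa Aa'].
  by case: pselect => // {}Aa; exact: set_mem (valP _).
case: pselect => // {}Aa; case: pselect => // {}Aa' /val_inj ff.
by have := @inj _ _ _ f _ _ (in_setT _) (in_setT _) ff => -[].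
Qed.

Lemma card_le_powerset (T U : Type) :
  [set: T] #<= [set: U] -> [set: set T] #<= [set: set U].
Proof.
move=> TU; have [[u0]|U0] := pselect ([set: U] !=set0); last first.
  apply: (@card_le_rel _ _ _ _ (fun _ _ => True)) => [a _|A A' _ _ _ _ _].
    by exists set0.
  have T0 : [set: T] = set0.
    apply/(@card_le0P _ U); apply: (card_le_trans TU); apply: subset_card_le.
    by move=> u _; apply: U0; exists u.
  by apply/seteqP; split=> t _; have : [set: T] t by []; rewrite T0.
move=> _; have [|f [_ finj]] := card_le_inj TU; first by exists u0.
apply: (@card_le_rel _ _ _ _ (fun A B => B = f @` A)) => [A _|A A' _ _ _ ->].
  by exists (f @` A).
by move=> /seteqP[sub1 sub2]; apply/seteqP; split=> a Aa;
  [have [//|a' Aa' /finj <-//] := sub1 (f a)|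
   have [//|a' Aa' /finj <-//] := sub2 (f a)]; exists a.
Qed.

Lemma well_order_wf (T : eqType) (R : rel T) :
  well_order R -> well_founded (fun x y => ~~ R y x).
Proof.
move=> Rwo x; apply: contrapT => nx.
have [|z [[zA zmin] _]] := Rwo (fun y => `[< ~ Acc (fun x y => ~~ R y x) y >]).
  by exists x; apply/asboolP.
move/asboolP: zA; apply; constructor => y /negP nzy; apply: contrapT => ny.
by apply: nzy; apply: zmin; apply/asboolP.
Qed.

Lemma wf_connected_exists (T : eqType) :
  exists lt : T -> T -> Prop,
    well_founded lt /\ forall x y, x <> y -> lt x y \/ lt y x.
Proof.
have [R Rwo] := well_ordering_principle T.
exists (fun x y => ~~ R y x); split=> [|x y xy]; first exact: well_order_wf.
apply: contrapT => /not_orP[/negP/negPn Ryx /negP/negPn Rxy].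
have Rrefl z : R z z.
  have [|w [[]]] := Rwo (pred1 z); first by exists z; rewrite inE.
  by rewrite inE => /eqP -> zz _; apply: zz; rewrite inE.
have [|w [_ wP]] := Rwo (pred2 x y); first by exists x; rewrite !inE eqxx.
apply: xy; rewrite -(wP x) ?(wP y)//; split; rewrite ?inE ?eqxx ?orbT//.
  by move=> z; rewrite !inE => /orP[]/eqP->.
by move=> z; rewrite !inE => /orP[]/eqP->.
Qed.

(** The functional receives a total function, equal to the default value [s0]
outside the predecessors of [a]; this avoids dependent arguments. *)
Lemma wf_recursion (T S : Type) (lt : T -> T -> Prop) (s0 : S)
    (F : T -> (T -> S) -> S) :
  well_founded lt ->
  exists x : T -> S,
    forall a, x a = F a (fun b => if pselect (lt b a) then x b else s0).
Proof.
move=> wf.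
pose G a (r : forall b, lt b a -> S) :=
  F a (fun b => if pselect (lt b a) is left h then r b h else s0).
exists (Fix wf (fun=> S) G) => a; rewrite Fix_eq.
  by congr F; apply/funext => b; case: pselect.
by move=> b f g fg; congr F; apply/funext => c; case: pselect.
Qed.

(** A sequence with a label in [J] codes one of the sets used in a closing-off
argument; the tokens over [A] are the codes with parameters in [A]. *)
Definition tokens (T J : Type) (A : set T) : set ((nat -> T) * J) :=
  [set t | forall n, A (t.1 n)].
Arguments tokens {T} J A.

(** * Arithmetic of the continuum when 2^{<c} = c *)

Section Cardinals.
Context (d : Order.disp_t) (C : orderType d).
Hypothesis hC : is_continuum C.
Hypothesis hweak : weak_power_eq C C.

Definition small (T : Type) (A : set T) := card_lt A [set: C].

Lemma continuum_powerset : [set: C] #= [set: set nat].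
Proof. by case: hC. Qed.

Lemma continuum_two : exists a b : C, a <> b.
Proof.
have := continuum_powerset; rewrite card_eq_le => /andP[_ hle].
have [[c _]|C0] := pselect ([set: C] !=set0); last first.
  have /card_le0P E : [set: set nat] #<= @set0 C.
    apply: (card_le_trans hle); apply: subset_card_le => c _; apply: C0.
    by exists c.
  by have : [set: set nat] set0 by []; rewrite E.
have [|f [_ finj]] := card_le_inj hle; first by exists c.
exists (f set0), (f setT) => /finj E.
by have : [set: nat] 0%N by []; rewrite -E.
Qed.

Lemma continuum_nonempty : [set: C] !=set0.
Proof. by have [a _] := continuum_two; exists a. Qed.

Lemma card_le_fun_powerset (I : Type) :
  [set: I -> C] #<= [set: set (I * nat)].
Proof.
have := continuum_powerset; rewrite card_eq_le => /andP[hle _].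
have [|f [_ finj]] := card_le_inj hle; first by exists set0.
apply: (@card_le_rel _ _ _ _
    (fun h B => B = [set p | f (h p.1) p.2])) => [h _|h h' _ _ _ ->].
  by exists [set p | f (h p.1) p.2].
move=> E; apply/funext => i; apply: finj => //; apply/seteqP.
by split=> n; [have := congr1 (@^~ (i, n)) E|have := congr1 (@^~ (i, n)) E];
  rewrite /= => ->.
Qed.

Lemma card_le_seq : [set: nat -> C] #<= [set: C].
Proof.
apply: (card_le_trans (card_le_fun_powerset nat)).
have := continuum_powerset; rewrite card_eq_le => /andP[_].
apply: card_le_trans; apply: card_le_powerset.
by have := card_nat2; rewrite card_eq_le => /andP[].
Qed.

Lemma card_le_pair : [set: C * C] #<= [set: C].
Proof.
apply: card_le_trans card_le_seq.
apply: (@card_le_rel _ _ _ _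
    (fun p h => h = fun n => if n is 0%N then p.1 else p.2)).
  by move=> p _; eexists.
move=> [a b] [a' b'] h _ _ -> E.
by have := congr1 (@^~ 0%N) E; have := congr1 (@^~ 1%N) E => /= -> ->.
Qed.

Lemma card_le_nat : [set: nat] #<= [set: C].
Proof.
have := continuum_powerset; rewrite card_eq_le => /andP[_].
apply: card_le_trans.
apply: (@card_le_rel _ _ _ _ (fun n A => A = [set n])) => [n _|n m A _ _ ->].
  by exists [set n].
by move=> E; have : [set n] n by []; rewrite E.
Qed.

Lemma card_le_bigcup (I T : Type) (Q : set I) (F : I -> set T) :
  Q #<= [set: C] -> (forall i, Q i -> F i #<= [set: C]) ->
  \bigcup_(i in Q) F i #<= [set: C].
Proof.
move=> /card_le_inj/(_ continuum_nonempty)[q [_ qinj]] FC.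
have /choice[f fP] i : exists f : T -> C, Q i ->
    forall a a', F i a -> F i a' -> f a = f a' -> a = a'.
  have [Qi|nQi] := pselect (Q i); last first.
    by have [c _] := continuum_nonempty; exists (fun=> c).
  by have [f [_ finj]] := card_le_inj (FC _ Qi) continuum_nonempty; exists f.
apply: card_le_trans card_le_pair.
apply: (@card_le_rel _ _ _ _
    (fun a p => exists i, [/\ Q i, F i a & p = (q i, f i a)])).
  by move=> a [i Qi Fia]; exists (q i, f i a) => //; exists i.
move=> a a' _ _ _ [i [Qi Fia ->]] [j [Qj Fja' [qij fij]]].
by have E := qinj _ _ Qi Qj qij; subst j; apply: fP fij.
Qed.

(** Konig's diagonal argument: if every [A i] were of size below c, a function
could be chosen whose [i]-th value differs from the [i]-th value of every
function coded in [A i], and it would have no code. It stands for all the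
cofinality arguments below; comparability of cardinals and multiplication of
infinite cardinals are thereby avoided. *)
Lemma konig (J T : Type) (A : J -> set T) :
  [set: J -> C] #<= [set: C] -> [set: C] #<= \bigcup_i A i ->
  exists i, [set: C] #<= A i.
Proof.
move=> JC CA; have [c0 _] := continuum_nonempty.
have [j [_ jinj]] := card_le_inj JC continuum_nonempty.
have [[t0]|T0] := pselect ([set: T] !=set0); last first.
  have /card_le0P E : [set: C] #<= @set0 T.
    by apply: (card_le_trans CA); apply: subset_card_le => t _;
      apply: T0; exists t.
  by have : [set: C] c0 by []; rewrite E.
move=> _; have [|f [fA finj]] := card_le_inj CA; first by exists t0.
apply: contrapT => nA.
have /choice[g gP] i : exists x, ~ exists2 h : J -> C, A i (f (j h)) & x = h i.
  apply: contrapT => /forallNP noex; apply: nA; exists i.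
  apply: (@card_le_rel _ _ _ _
    (fun x t => exists2 h : J -> C, t = f (j h) & x = h i)).
    by move=> x _; have /contrapT[h Ah xh] := noex x;
      exists (f (j h)) => //; exists h.
  move=> _ _ _ _ _ [h -> ->] [h' E ->].
  by rewrite (jinj h h' I I (finj _ _ I I E)).
have [//|i _ Ai] := fA (j g).
by apply: (gP i); exists g.
Qed.

Lemma small_le (T U : Type) (A : set T) (B : set U) :
  A #<= B -> small B -> small A.
Proof.
move=> AB [BC nCB]; split; first exact: card_le_trans BC.
by move=> CA; apply: nCB; exact: card_le_trans AB.
Qed.

Lemma small_sub (T : Type) (A B : set T) : A `<=` B -> small B -> small A.
Proof. by move=> /subset_card_le; exact: small_le. Qed.

Lemma small_image (T U : Type) (f : T -> U) (A : set T) :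
  small A -> small (f @` A).
Proof. exact/small_le/card_image_le. Qed.

Lemma small_seg (b : C) : small [set a : C | (a < b)%O].
Proof. by case: hC => -[_ +] _; apply. Qed.

Lemma small_set1 (T : Type) (x : T) : small [set x].
Proof.
have [a [b ab]] := continuum_two.
split.
  apply: (@card_le_rel _ _ _ _ (fun _ c => c = a)) => [y _|y z c -> ->//].
  by exists a.
move=> /card_le_inj[|f [fx finj]]; first by exists x.
by apply: ab; apply: finj => //; rewrite (fx a I) (fx b I).
Qed.

Lemma small_countable (T : Type) (A : set T) : countable A -> small A.
Proof.
move=> Ac; apply: (small_le Ac); split; first exact: card_le_nat.
move=> CN; have [||n] := @konig nat nat (fun n => [set n]).
- exact: card_le_seq.
- by apply: (card_le_trans CN); apply: subset_card_le => n _; exists n.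
- by case: (small_set1 n).
Qed.

(** Such functions are coded by subsets of [Q * nat], so it is enough that
[Q * nat] is small. This is an instance of [konig] with index type [nat]. *)
Lemma card_le_fun_small (I : Type) (Q : set I) :
  small Q -> [set: Q -> C] #<= [set: C].
Proof.
move=> sQ; apply: (card_le_trans (card_le_fun_powerset Q)).
have sQ' : small [set: Q].
  by apply: small_le sQ; have := card_setT Q; rewrite card_eq_le => /andP[].
apply: hweak.1; split.
  apply: (@card_le_trans _ _ _
      (\bigcup_(n in [set: nat]) [set p : Q * nat | p.2 = n])).
    by apply: subset_card_le => p _; exists p.2.
  apply: card_le_bigcup => [|n _]; first exact: card_le_nat.
  apply: (@card_le_trans _ _ _ [set: Q]); last exact: sQ'.1.
  apply: (@card_le_rel _ _ _ _ (fun p q => p.1 = q)) => [p _|].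
    by exists p.1.
  by move=> [q m] [q' m'] x /= -> -> -> ->.
move=> CQ; have [||n] := @konig nat _ (fun n => [set p : Q * nat | p.2 = n]).
- exact: card_le_seq.
- by apply: (card_le_trans CQ); apply: subset_card_le => p _; exists p.2.
- move=> Cn; apply: sQ'.2; apply: (card_le_trans Cn).
  apply: (@card_le_rel _ _ _ _ (fun p q => p.1 = q)) => [p _|].
    by exists p.1.
  by move=> [q m] [q' m'] x /= -> -> -> ->.
Qed.

(** Regularity of the continuum. *)
Lemma small_bigcup (I T : Type) (Q : set I) (F : I -> set T) :
  small Q -> (forall i, Q i -> small (F i)) -> small (\bigcup_(i in Q) F i).
Proof.
move=> sQ sF; split.
  by apply: card_le_bigcup => [|i /sF[]//]; case: sQ.
rewrite bigcup_set_type => /konig[|i]; first exact: card_le_fun_small.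
by have [] := sF _ (set_mem (valP i)).
Qed.

Lemma small_setU (T : Type) (A B : set T) :
  small A -> small B -> small (A `|` B).
Proof.
move=> sA sB; rewrite -bigcup2E; apply: small_bigcup => [|[|[|n]] _] //=.
  by apply: small_countable; exact: countableP.
by apply: small_countable; exact: countable0.
Qed.

(** Otherwise c would be the union of the small sets [{a | a <= q}] for [q] in
[Q]. *)
Lemma small_bounded (Q : set C) :
  small Q -> exists b, forall q, Q q -> (q < b)%O.
Proof.
move=> sQ; apply: contrapT => /forallNP unb.
suff [_] : small [set: C] by rewrite card_lexx.
apply: (@small_sub _ _ (\bigcup_(q in Q) ([set a | (a < q)%O] `|` [set q]))).
  move=> b _; have /existsNP[q /not_implyP[Qq /negP]] := unb b.
  rewrite -leNgt le_eqVlt => /predU1P[->|bq]; exists q => //; first by right.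
  by left.
apply: small_bigcup => // q _.
by apply: small_setU; [exact: small_seg|exact: small_set1].
Qed.

Lemma large_unbounded (S : set C) (b : C) :
  S #= [set: C] -> exists2 c, S c & (b < c)%O.
Proof.
move=> SC; apply: contrapT => nS.
suff [_] : small S by move: SC; rewrite card_eq_le => /andP[_ ->].
apply: (@small_sub _ _ ([set a | (a < b)%O] `|` [set b])).
  move=> c Sc; have : (c <= b)%O.
    by rewrite leNgt; apply/negP => bc; apply: nS; exists c.
  by rewrite le_eqVlt => /predU1P[->|cb]; [right|left].
by apply: small_setU; [exact: small_seg|exact: small_set1].
Qed.

(** By regularity every small subset of c lies in an initial segment, and each of
the c initial segments has at most c subsets because 2^{<c} = c. *)
Lemma card_le_small_subsets (T : Type) (A : set T) :
  A #<= [set: C] -> [set Q : set T | Q `<=` A /\ small Q] #<= [set: C].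
Proof.
move=> /card_le_inj/(_ continuum_nonempty)[f [_ finj]].
apply: (@card_le_trans _ _ _ [set Q : set C | small Q]).
  apply: (@card_le_rel _ _ _ _ (fun Q P => P = f @` Q)) => [Q [_ sQ]|].
    by exists (f @` Q) => //; exact: small_image.
  move=> Q Q' _ [QA _] [Q'A _] -> /seteqP[s1 s2]; apply/seteqP; split=> a Qa.
    have [|a' Qa' E] := s1 (f a); first by exists a.
    by rewrite (finj a a')//; [exact: QA|exact: Q'A].
  have [|a' Qa' E] := s2 (f a); first by exists a.
  by rewrite (finj a a')//; [exact: Q'A|exact: QA].
apply: (@card_le_trans _ _ _
    (\bigcup_(b in [set: C]) [set Q : set C | Q `<=` [set a | (a < b)%O]])).
  by apply: subset_card_le => Q /small_bounded[b Qb]; exists b.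
apply: card_le_bigcup => [|b _]; first exact: card_lexx.
apply: (@card_le_trans _ _ _ [set: set (set_type [set a : C | (a < b)%O])]).
  apply: (@card_le_rel _ _ _ _ (fun Q P => P = [set x | Q (val x)])).
    by move=> Q _; exists [set x | Q (val x)].
  move=> Q Q' _ Qb Q'b -> E; apply/seteqP; split=> a Qa.
    have h := mem_set (Qb _ Qa).
    by have := congr1 (@^~ (SigSub h)) E => /= <-.
  have h := mem_set (Q'b _ Qa).
  by have := congr1 (@^~ (SigSub h)) E => /= ->.
apply: hweak.1; apply: small_le (small_seg b).
by have := card_setT [set a : C | (a < b)%O]; rewrite card_eq_le => /andP[].
Qed.

Lemma continuum_wf : well_founded (fun a b : C => (a < b)%O).
Proof.
have [[/well_order_wf wf _] _] := hC.
by move=> x; elim/(well_founded_ind wf): x => x IH; constructor => y yx;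
  apply: IH; rewrite -ltNge.
Qed.

Lemma transfinite_construction (T : Type) (P : set T -> T -> Prop) :
  (forall Q, small Q -> exists y, P Q y) ->
  exists x : C -> T, forall a, P (x @` [set b | (b < a)%O]) (x a).
Proof.
move=> ex; have [|t0 _] := ex set0; first exact/small_countable/countable0.
have /choice[F FP] Q : exists y, small Q -> P Q y.
  by have [/ex[y]|] := pselect (small Q); [exists y|exists t0].
have [x xP] := wf_recursion t0 (fun a g => F (g @` [set b | (b < a)%O]))
  continuum_wf.
exists x => a; have := FP (x @` [set b | (b < a)%O]).
have <- : x a = F (x @` [set b | (b < a)%O]).
  rewrite xP; congr F; apply: eq_imagel => b /= ba.
  by case: pselect.
by apply; apply: small_image; exact: small_seg.
Qed.

Lemma card_le_tokens (T J : Type) (A : set T) :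
  A #<= [set: C] -> [set: J] #<= [set: C] -> tokens J A #<= [set: C].
Proof.
move=> /card_le_inj/(_ continuum_nonempty)[f [_ finj]].
move=> /card_le_inj/(_ continuum_nonempty)[j [_ jinj]].
have [e [_ einj]] := card_le_inj card_le_seq continuum_nonempty.
apply: card_le_trans card_le_pair.
apply: (@card_le_rel _ _ _ _ (fun t p => p = (e (f \o t.1), j t.2))) => [t _|].
  by eexists.
move=> [s i] [s' i'] _ /= As As' -> [/einj ss' /jinj ii'].
rewrite (ii' I I); congr (_, _); apply/funext => n.
by apply: finj => //; exact: (congr1 (@^~ n) (ss' I I)).
Qed.

(** The set [A] is the union of c stages, stage [a] consisting of the values of
[F] at small sets of tokens over the earlier stages. A small set of tokens over
[A] is a set of tokens over some stage, since c is regular and uncountable, so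
nothing has to be added after c stages. *)
Lemma closing_off (T J : Type) (F : set ((nat -> T) * J) -> T) :
  [set: J] #<= [set: C] ->
  exists A : set T, A #<= [set: C] /\
    forall Q, small Q -> Q `<=` tokens J A -> A (F Q).
Proof.
move=> JC.
have [stage stageP] := wf_recursion set0 (fun _ (g : C -> set T) =>
  F @` [set Q | Q `<=` tokens J (\bigcup_b g b) /\ small Q]) continuum_wf.
have {}stageP a : stage a = F @` [set Q |
    Q `<=` tokens J (\bigcup_(b in [set b | (b < a)%O]) stage b) /\ small Q].
  rewrite [LHS]stageP [in RHS]bigcup_mkcond.
  do 2 f_equal; apply/funext => Q; do 3 f_equal.
  apply: eq_bigcupr => b _.
  by case: pselect => ba; case: ifPn; rewrite ?inE ?notin_setE.
exists (\bigcup_a stage a); split.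
  apply: card_le_bigcup => [|a _]; first exact: card_lexx.
  elim/(well_founded_ind continuum_wf): a => a IH; rewrite stageP.
  apply: (card_le_trans (card_image_le _ _)).
  apply: card_le_small_subsets; apply: card_le_tokens => //.
  by apply: card_le_bigcup => [|b /IH//]; exact: card_leT.
move=> Q sQ QA.
have /choice[c cP] (t : (nat -> T) * J) : exists c, Q t ->
    forall n, exists2 b, (b < c)%O & stage b (t.1 n).
  have [Qt|nQt] := pselect (Q t); last first.
    by have [c _] := continuum_nonempty; exists c.
  have /choice[a aP] n : exists a, stage a (t.1 n).
    by have [a _ st] := QA _ Qt n; exists a.
  have [c cP] : exists c, forall q, range a q -> (q < c)%O.
    by apply/small_bounded/small_image/small_countable/countableP.
  by exists c => _ n; exists (a n) => //; apply: cP; exists n.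
have [m mP] := small_bounded (small_image c sQ).
exists m => //; rewrite stageP; exists Q => //; split=> // t Qt n.
have [b bc st] := cP _ Qt n; exists b => //=.
by apply: (lt_trans bc); apply: mP; exists t.
Qed.

End Cardinals.

(** * Spaces of countable spread *)

Lemma isolated_discrete (X : topologicalType) (D : set X) (W : X -> set X) :
  (forall x, D x -> open (W x)) ->
  (forall x, D x -> W x x) ->
  (forall x y, D x -> D y -> W x y -> y = x) ->
  discrete_subspace D.
Proof.
move=> Wo Wx WD U.
exists (\bigcup_(x in [set val u | u in U]) W x).
  by apply: bigcup_open => _ [u _ <-]; apply: Wo; exact: set_mem (valP u).
apply/seteqP; split=> [u [_ [v Uv <-]] Wvu|u Uu].
  have E : val u = val v.
    by apply: WD Wvu; [exact: set_mem (valP v)|exact: set_mem (valP u)].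
  by rewrite (val_inj E).
by exists (val u); [exists u|apply: Wx; exact: set_mem (valP u)].
Qed.

Lemma closure_disjoint_open (X : topologicalType) (A U : set X) (x : X) :
  open U -> U x -> (forall y, A y -> ~ U y) -> ~ closure A x.
Proof.
move=> Uo Ux AU clA; have [y [Ay Uy]] := clA U (open_nbhs_nbhs (conj Uo Ux)).
exact: (AU y).
Qed.

(** Run through Y along a well-founded connected relation and keep a point when
it is neither in the closure of the kept points before it nor in one of their
neighbourhoods. The kept points form a discrete subspace: [U x] avoids the later
ones and the complement of the closure avoids the earlier ones. *)
Lemma shapirovskii (X : topologicalType) (Y : set X) (U : X -> set X) :
  countable_spread X ->
  (forall y, Y y -> open (U y)) -> (forall y, Y y -> U y y) ->
  exists D, [/\ D `<=` Y, countable D &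
    Y `<=` closure D `|` \bigcup_(y in D) U y].
Proof.
move=> hX Uo Uy.
have [lt [ltwf ltc]] := wf_connected_exists X.
pose F y (g : set X) := [/\ Y y, ~ closure g y & forall z, g z -> ~ U z y].
have [D DP] := wf_recursion False F ltwf.
have {}DP y : D y = F y [set z | D z /\ lt z y].
  rewrite DP; congr F; apply/funext => z.
  by case: pselect => h; apply/propext; split=> // -[].
have DY : D `<=` Y by move=> y; rewrite DP => -[].
exists D; split=> //.
  apply: hX; apply: (@isolated_discrete _ _ (fun y =>
      U y `&` ~` closure [set z | D z /\ lt z y])).
  - move=> y /DY Yy; apply: openI; first exact: Uo.
    exact/closed_openC/closed_closure.
  - by move=> y Dy; split; [exact/Uy/DY|move: Dy; rewrite DP => -[]].
  - move=> x y Dx Dy [Uxy ncl]; apply: contrapT => /ltc[yx|xy].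
      by apply: ncl; exact: subset_closure.
    by move: Dy; rewrite DP => -[_ _ /(_ x (conj Dx xy))].
move=> y Yy; apply: contrapT => /not_orP[ncl nU].
apply: (nU); exists y; last exact: Uy.
rewrite DP; split=> // [|z [Dz _] Uzy]; last by apply: nU; exists z.
by move=> cl; apply: ncl; apply: (closureS _ cl) => z [].
Qed.

Section ColoringProperty.
Context (d : Order.disp_t) (C : orderType d).
Hypothesis hC : is_continuum C.
Hypothesis hweak : weak_power_eq C C.
Hypothesis hstar : coloring_property C.

(** A relation between a smaller and a larger index is turned into a colouring
of pairs. *)
Lemma coloring_relation (R : C -> C -> Prop) :
  (exists H : set C, H #= [set: C] /\
     forall a b, H a -> H b -> (a < b)%O -> ~ R a b) \/
  (exists S : set C, S #= [set: C] /\
     forall A, countable A -> A `<=` S ->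
       exists b, forall a, A a -> (a < b)%O /\ R a b).
Proof.
pose k (s : set C) :=
  `[< exists a b, [/\ (a < b)%O, s = [set a; b] & R a b] >].
have [[H [HC Hk]]|[S [SC Sk]]] := hstar k; [left|right].
  exists H; split=> // a b Ha Hb ab Rab.
  suff /negP : ~~ k [set a; b] by apply; apply/asboolP; exists a, b.
  apply/negbT/Hk; split; first by move=> c [->|->].
  apply/eq_cardSP; exists a; first by left.
  rewrite (_ : _ `\` _ = [set b]) ?card_set1//; apply/seteqP; split=> c /=.
    by move=> [[->|->]].
  by move=> ->; split; [right|move=> ba; move: ab; rewrite ba ltxx].
exists S; split=> // A cA AS; have [b [Ab kb]] := Sk A cA AS.
exists b => a Aa; split; first exact: Ab.
have /asboolP[a' [b' [ab' E Rab]]] := kb a Aa.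
have ab : (a < b)%O := Ab _ Aa.
have a'P : [set a; b] a' by rewrite E; left.
have b'P : [set a; b] b' by rewrite E; right.
case: a'P b'P ab' Rab => [->|->] [->|->] //; rewrite ?ltxx//.
by move=> /(lt_trans ab); rewrite ltxx.
Qed.

Context (X : topologicalType).
Hypothesis hX : countable_spread X.

Lemma no_large_discrete (H : set C) (x : C -> X) (W : C -> set X) :
  H #= [set: C] ->
  (forall a, open (W a)) -> (forall a, W a (x a)) ->
  (forall a b, H a -> H b -> W a (x b) -> a = b) -> False.
Proof.
move=> HC Wo Wx WH.
have xinj a b : H a -> H b -> x a = x b -> a = b.
  by move=> Ha Hb E; apply: WH => //; rewrite -E.
have sH : small C H.
  apply: (@small_le _ _ _ _ _ (x @` H)).
    apply: (@card_le_rel _ _ _ _ (fun a y => y = x a)).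
      by move=> a Ha; exists (x a) => //; exists a.
    by move=> a b y Ha Hb -> /(xinj _ _ Ha Hb).
  apply: small_countable => //; apply: hX.
  have /choice[r rP] y : exists a, (x @` H) y -> H a /\ x a = y.
    have [[a Ha <-]|nHy] := pselect ((x @` H) y); first by exists a.
    by have [a _] := continuum_nonempty hC; exists a.
  apply: (@isolated_discrete _ _ (W \o r)) => /=.
  - by move=> y _; exact: Wo.
  - by move=> y /rP[_ E]; rewrite -[X in W _ X]E.
  - move=> y z Hy Hz; have [[Hry Ey] [Hrz Ez]] := (rP _ Hy, rP _ Hz).
    rewrite -{1}Ez => Wyz; have E : r y = r z by apply: WH.
    by rewrite -Ez -E.
by case: sH => _; move: HC; rewrite card_eq_le => /andP[_ ->].
Qed.

(** Shapirovskii's lemma for an indexed family of points whose neighbourhoods are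
taken from an indexed family of open sets, possibly at another index. *)
Lemma index_shapirovskii (T S : set C) (x : C -> X) (V : C -> set X) :
  (forall a, open (V a)) ->
  (forall a, T a -> exists2 b, S b & V b (x a)) ->
  exists A B, [/\ A `<=` T, B `<=` S, countable A, countable B &
    x @` T `<=` closure (x @` A) `|` \bigcup_(b in B) V b].
Proof.
move=> Vo TV.
have [c0 _] := continuum_nonempty hC.
have /choice[r rP] y : exists p : C * C, (x @` T) y ->
    [/\ T p.1, x p.1 = y, S p.2 & V p.2 y].
  have [[a Ta <-]|nTy] := pselect ((x @` T) y); last by exists (c0, c0).
  by have [b Sb Vb] := TV a Ta; exists (a, b).
have [||D [DT cD cov]] := @shapirovskii X (x @` T) (fun y => V (r y).2) hX.
- by move=> y _; exact: Vo.
- by move=> y /rP[].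
have cim (T' : Type) (g : X -> T') : countable (g @` D).
  by apply: sub_countable cD; exact: card_image_le.
exists ((fst \o r) @` D), ((snd \o r) @` D); split=> //.
- by move=> _ [y /DT/rP[? _ _ _] <-].
- by move=> _ [y /DT/rP[_ _ ? _] <-].
move=> y /cov[clD|[z Dz Vz]].
  left; apply: (closureS _ clD) => z Dz.
  by exists (r z).1; [exists z|have [] := rP _ (DT _ Dz)].
by right; exists (r z).2 => //; exists z.
Qed.

(** Colour a pair [a < b] by whether [x a] is in [U b]. *)
Lemma no_right_separated (x : C -> X) (U : C -> set X) :
  (forall a, open (U a)) -> (forall a, U a (x a)) ->
  (forall a b, (a < b)%O -> ~ closure (U a) (x b)) -> False.
Proof.
move=> Uo Ux Usep.
have [[H [HC Hk]]|[S [SC Sk]]] :=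
    coloring_relation (fun a b => U b (x a)).
  apply: (no_large_discrete HC Uo Ux) => a b Ha Hb Uab.
  have [ab|ba|//] := ltgtP a b; last by case: (Hk _ _ Hb Ha ba).
  by case: (Usep _ _ ab); exact: subset_closure.
have [a Sa|A [B [AS BS cA cB cov]]] :=
    index_shapirovskii (T := S) (S := S) (x := x) Uo.
  by exists a.
have [b bA] := Sk A cA AS.
have [m mB] := small_bounded hC hweak (small_countable hC cB).
have [c Sc mc] := large_unbounded hC hweak (Order.max b m) SC.
have {mc} [bc mc] : (b < c)%O /\ (m < c)%O by move: mc; rewrite gt_max => /andP.
have [clA|[b' /mB b'm Ub']] : (closure (x @` A) `|` \bigcup_(b in B) U b) (x c).
- by apply: cov; exists c.
- apply: (Usep _ _ bc); apply: (closureS _ clA) => _ [a Aa <-].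
  by have [] := bA a Aa.
- by apply: (Usep _ _ (lt_trans b'm mc)); exact: subset_closure.
Qed.

(** Colour a pair [a < b] by whether [x b] is in [U a]. *)
Lemma no_left_separated (x : C -> X) (U : C -> set X) :
  (forall a, open (U a)) -> (forall a, U a (x a)) ->
  (forall a b, (a < b)%O -> ~ closure (U b) (x a)) -> False.
Proof.
move=> Uo Ux Usep.
have [[H [HC Hk]]|[S [SC Sk]]] :=
    coloring_relation (fun a b => U a (x b)).
  apply: (no_large_discrete HC Uo Ux) => a b Ha Hb Uab.
  have [ab|ba|//] := ltgtP a b; first by case: (Hk _ _ Ha Hb ab).
  by case: (Usep _ _ ba); exact: subset_closure.
have Vo a : open (~` closure (U a)) by exact/closed_openC/closed_closure.
have [a Sa|A [B [AS BS cA cB cov]]] :=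
    index_shapirovskii (T := setT) (S := S) (x := x) Vo.
  by have [b Sb ab] := large_unbounded hC hweak a SC;
    exists b => //; exact: Usep.
have [m mA] := small_bounded hC hweak (small_countable hC cA).
(* The index [e] joins [B] so that the index [b] found below is beyond [m],
   hence beyond all of [A]. *)
have [e Se me] := large_unbounded hC hweak m SC.
have [||b bP] := Sk (B `|` [set e]).
- by rewrite -bigcup2E; apply: bigcup_countable => [|[|[|n]] _] //=.
- by move=> c [/BS//|->].
have [eb _] : (e < b)%O /\ U e (x b) by apply: bP; right.
have [clA|[b' Bb' nU]] :
    (closure (x @` A) `|` \bigcup_(b in B) ~` closure (U b)) (x b).
- by apply: cov; exists b.
- apply: (closure_disjoint_open (Uo b) (Ux b)) clA.
  move=> _ [a /mA am <-] Ub; apply: (Usep a b); last exact: subset_closure.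
  by apply: (lt_trans am); exact: lt_trans eb.
- by apply: nU; apply: subset_closure; have [|] := bP b'; first by left.
Qed.

(** Give each [y] other than [p] a neighbourhood [U y] whose closure avoids [p].
If no small number of these closures covered the complement of [p], picking
successively uncovered points would give a right-separated sequence of length
c. *)
Lemma small_pseudocharacter (p : X) : hausdorff_space X ->
  exists N : set (set X), [/\ small C N, forall W, N W -> open W /\ W p &
    forall y, y <> p -> exists2 W, N W & ~ W y].
Proof.
rewrite open_hausdorff => T2.
have /choice[U UP] y : exists U, [/\ open U, ~ closure U p & y <> p -> U y].
  have [->|/eqP/T2[[A B] /= []]] := pselect (y = p).
    (* The empty set serves at [p], so that [U] is defined everywhere. *)
    by exists set0; split; [exact: open0|rewrite closure0|].
  rewrite !inE => Ay Bp [Ao Bo AB]; exists A; split=> //.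
  apply: (closure_disjoint_open Bo Bp) => z Az Bz.
  by have : (A `&` B) z by []; rewrite AB.
have [ex|/existsNP[Q /not_implyP[sQ nQ]]] := pselect (forall Q, small C Q ->
    exists y, y <> p /\ forall q, Q q -> ~ closure (U q) y).
  have [x xP] := transfinite_construction hC ex.
  have [] := @no_right_separated x (U \o x) => [a|a|a b ab] /=.
  - by have [] := UP (x a).
  - by have [_ _] := UP (x a); apply; have [] := xP a.
  - by have [_] := xP b; apply; exists a.
exists ((fun q => ~` closure (U q)) @` Q); split; first exact: small_image.
  move=> _ [q _ <-]; split; first exact/closed_openC/closed_closure.
  by have [] := UP q.
move=> y yp; apply: contrapT => nW; apply: nQ; exists y; split=> // q Qq clU.
by apply: nW; exists (~` closure (U q)); [exists q|apply].
Qed.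

(** The two kinds of tokens in the closing-off argument below are labelled by
[option C]. *)
Lemma card_le_option : [set: option C] #<= [set: C].
Proof.
have [a [b ab]] := continuum_two hC.
apply: card_le_trans (card_le_pair hC).
apply: (@card_le_rel _ _ _ _
    (fun o q => q = if o is Some c then (c, a) else (a, b))).
  by move=> o _; eexists.
move=> [c|] [c'|] q _ _ -> //; first by case=> ->.
  by case=> _ /ab.
by case=> _ /esym/ab.
Qed.

(** Let [A] be closed off for two kinds of tokens: closures of countable subsets
of [A], and members of the small families [N x] with intersection [{x}], for [x]
in [A]. Suppose that [y] is not in [A]. For each [W] in [N y], Shapirovskii's lemma
covers [A `\` W] by countably many tokens, and none of them contains [y]: the
neighbourhoods are chosen to avoid [y], and the closure is that of a set disjoint
from the open set [W]. As [N y] is small, [A] is covered by a small number of tokens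
that do not cover X, which contradicts the closure property of [A]. *)
Lemma hausdorff_card : hausdorff_space X -> [set: X] #<= [set: C].
Proof.
move=> T2; have [[x0 _]|X0] := pselect ([set: X] !=set0); last first.
  by rewrite (_ : [set: X] = set0) ?card_ge0//; apply/seteqP; split=> x // _;
    apply: X0; exists x.
have /choice[N NP] p := small_pseudocharacter p T2.
have /choice[f finj] p : exists f : set X -> C,
    forall W W', N p W -> N p W' -> f W = f W' -> W = W'.
  have [[+ _] _ _] := NP p.
  by move=> /card_le_inj/(_ (continuum_nonempty hC))[f []]; exists f.
(* The token [(s, Some (f (s 0) W))] stands for [W] when [W] is in [N (s 0)], as
   [f (s 0)] is injective there. *)
pose piece (t : (nat -> X) * option C) : set X :=
  if t.2 is Some c then
    [set z | forall W, N (t.1 0%N) W -> f (t.1 0%N) W = c -> W z]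
  else closure (range t.1).
have /choice[F FP] (Q : set ((nat -> X) * option C)) : exists z,
    (exists y, ~ (\bigcup_(t in Q) piece t) y) ->
    ~ (\bigcup_(t in Q) piece t) z.
  have [[y Qy]|] := pselect (exists y, ~ (\bigcup_(t in Q) piece t) y).
    by exists y.
  by exists x0.
have [A [AC AF]] := closing_off hC hweak F card_le_option.
apply: card_le_trans AC; apply: subset_card_le => y _; apply: contrapT => nAy.
have neqA x : A x -> x <> y by move=> Ax xy; apply: nAy; rewrite -xy.
have /choice[G GP] x : exists W, A x -> N x W /\ ~ W y.
  have [Ax|] := pselect (A x); last by exists setT.
  have [_ _ /(_ y (nesym (neqA _ Ax)))[W NW nWy]] := NP x.
  by exists W.
have /choice[Q QP] W : exists Q : set ((nat -> X) * option C), N y W ->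
    [/\ countable Q, Q `<=` tokens (option C) A, forall t, Q t -> ~ piece t y &
        A `\` W `<=` \bigcup_(t in Q) piece t].
  have [NW|] := pselect (N y W); last by exists set0.
  have [Wo Wy] : open W /\ W y by have [_ NyP _] := NP y; exact: NyP.
  have [x [Ax _]|x [Ax _]|D [DA cD cov]] := @shapirovskii X (A `\` W) G hX.
  - have [NG _] := GP _ Ax.
    by have [_ NxP _] := NP x; have [] := NxP _ NG.
  - have [NG _] := GP _ Ax.
    by have [_ NxP _] := NP x; have [] := NxP _ NG.
  have pieceG b : D b -> piece (fun=> b, Some (f b (G b))) = G b.
    move=> /DA[Ab _]; have [NGb _] := GP _ Ab.
    apply/seteqP; split=> z /=; first by apply.
    by move=> Gz W' NW' /finj ->.
  have ncl : ~ closure D y.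
    by apply: (closure_disjoint_open Wo Wy) => z /DA[].
  (* The empty set has no enumeration, but its closure is empty and needs no
     token. *)
  have [M [cM MA My DM]] : exists M : set ((nat -> X) * option C),
      [/\ countable M, M `<=` tokens (option C) A,
          forall t, M t -> ~ piece t y & closure D `<=` \bigcup_(t in M) piece t].
    have /pfcard_geP[D0|/surjfunPex[s Ds]] := cD.
      by exists set0; rewrite D0 closure0; split.
    exists [set (s, None)]; split.
    - exact: countable1.
    - move=> _ -> n /=; have [] : (A `\` W) (s n) => //.
      by apply: DA; rewrite Ds; exists n.
    - by move=> _ ->; rewrite /piece /= -Ds.
    - by move=> z Dz; exists (s, None) => //; rewrite /piece /= -Ds.
  exists (M `|` (fun b => (fun=> b, Some (f b (G b)))) @` D) => _; split.
  - rewrite -bigcup2E; apply: bigcup_countable => [|[|[|n]] _] //=.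
    by apply: sub_countable cD; exact: card_image_le.
  - by move=> t [/MA//|[b /DA[Ab _] <-] n].
  - move=> t [/My//|[b Db <-]]; rewrite pieceG//.
    by have [Ab _] := DA _ Db; have [] := GP _ Ab.
  - move=> z /cov[/DM[t Mt tz]|[b Db Gz]]; first by exists t => //; left.
    exists (fun=> b, Some (f b (G b))); first by right; exists b.
    by rewrite pieceG.
pose QQ := \bigcup_(W in N y) Q W.
have sQQ : small C QQ.
  apply: small_bigcup => // [|W /QP[cQ _ _ _]]; first by have [] := NP y.
  exact: small_countable.
have AFQ : A (F QQ).
  by apply: AF => // t [W NW Qt]; have [_ QA _ _] := QP W NW; exact: QA.
apply: (FP QQ).
  exists y => -[t [W NW Qt]]; have [_ _ nty _] := QP W NW; exact: nty.
have [_ _ /(_ _ (neqA _ AFQ))[W NW nWF]] := NP y.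
have [_ _ _ /(_ (F QQ) (conj AFQ nWF))[t Qt tF]] := QP W NW.
by exists t => //; exists W.
Qed.

(** Otherwise points of [F] outside the closure of the earlier ones can be picked
c times; as X is regular, this is a left-separated sequence. *)
Lemma regular_closed_small_dense (F : set X) : regular_space X -> closed F ->
  exists2 Q, small C Q & F = closure Q.
Proof.
move=> reg Fc.
have [ex|/existsNP[Q /not_implyP[sQ nQ]]] := pselect (forall Q, small C Q ->
    exists y, F y /\ ~ closure (Q `&` F) y); last first.
  exists (Q `&` F); first by apply: small_sub sQ => x [].
  apply/seteqP; split=> y.
    by move=> Fy; apply: contrapT => ncl; apply: nQ; exists y.
  by move=> cl; rewrite (iffLR (closure_id F) Fc);
    apply: (closureS _ cl) => z [].
have [x xP] := transfinite_construction hC ex.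
have /choice[U UP] a : exists U, [/\ open U, U (x a) &
    forall b, (b < a)%O -> ~ closure U (x b)].
  have [_ ncl] := xP a.
  have /reg[B nB clB] :
      nbhs (x a) (~` closure ((x @` [set b | (b < a)%O]) `&` F)).
    apply: open_nbhs_nbhs; split=> //; exact/closed_openC/closed_closure.
  exists B^°; split; [exact: open_interior|exact: nB|] => b ba clU.
  apply: (clB (x b)); first exact: (closureS (@interior_subset _ B) clU).
  by apply: subset_closure; split; [exists b|have [] := xP b].
have [] := @no_left_separated x U => [a|a|a b ab].
- by have [] := UP a.
- by have [] := UP a.
- by have [_ _] := UP b; apply.
Qed.

Lemma card_open_le : hausdorff_space X -> regular_space X ->
  [set U : set X | open U] #<= [set: C].
Proof.
move=> /hausdorff_card XC reg.
apply: card_le_trans (card_le_small_subsets hC hweak XC).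
apply: (@card_le_rel _ _ _ _ (fun U Q => ~` U = closure Q)) => [U Uo|].
  have [|Q sQ UQ] := regular_closed_small_dense (F := ~` U) reg.
    exact: open_closedC.
  by exists Q.
by move=> U V Q _ _ UQ VQ; apply: setC_inj; rewrite UQ VQ.
Qed.

End ColoringProperty.

(** Take disjoint open sets [A] and [B] around two points [x] and [y] of [G]. If
what remains of [G] outside the closure of [A] is finite, then it contains the open
set [B `&` G], which is therefore finite, and so [y] is isolated. *)
Lemma hausdorff_open_split (X : topologicalType) (G : set X) :
  hausdorff_space X -> open G -> infinite_set G ->
  exists U G' : set X, [/\ open U, U !=set0, U `<=` G &
    [/\ open G', infinite_set G', G' `<=` G & U `&` G' = set0]].
Proof.
move=> T2 Go Ginf; have T1 := hausdorff_accessible T2.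
have [x Gx] := infinite_setN0 Ginf.
have [y [Gy /= yx]] : (G `\` [set x]) !=set0.
  by apply: infinite_setN0; apply: infinite_setD => //; exact: finite_set1.
move: (T2); rewrite open_hausdorff => T2'.
have [|[A B] /= [] +] := T2' x y; first by apply/eqP => xy; apply: yx.
rewrite !inE => Ax By [Ao Bo AB].
have [inf|/contrapT fin] := pselect (infinite_set (G `\` closure (A `&` G))).
  exists (A `&` G), (G `\` closure (A `&` G)); split.
  - exact: openI.
  - by exists x.
  - exact: subIsetr.
  - split=> //; last by apply/seteqP; split=> // z [+ [_]];
      move=> /subset_closure.
    by apply: openI => //; exact/closed_openC/closed_closure.
have Bfin : finite_set (B `&` G).
  apply: sub_finite_set fin => z [Bz Gz]; split=> //.
  apply: (closure_disjoint_open Bo Bz) => t [At _] Bt.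
  by have : (A `&` B) t by []; rewrite AB.
have oy : open [set y].
  have -> : [set y] = (B `&` G) `\` ((B `&` G) `\` [set y]).
    apply/seteqP; split=> [z ->|z [BGz nz]]; first by split=> [//|[_]]; apply.
    by apply: contrapT => zy; apply: nz.
  apply: openI; first exact: openI.
  apply: closed_openC; apply: (iffLR accessible_finite_set_closed T1).
  exact: finite_setD.
exists [set y], (G `\` [set y]); split=> //.
- by exists y.
- by move=> z ->.
- split=> //.
  + by apply: openI => //; exact/closed_openC/accessible_closed_set1.
  + by apply: infinite_setD => //; exact: finite_set1.
  + by apply/seteqP; split=> // z [-> [_]]; apply.
Qed.

Lemma infinite_hausdorff_disjoint_opens (X : topologicalType) :
  hausdorff_space X -> infinite_set [set: X] ->
  exists O : nat -> set X, [/\ forall n, open (O n), forall n, O n !=set0 &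
    forall m n, (m < n)%N -> O m `&` O n = set0].
Proof.
move=> T2 Xinf.
have /choice[step stepP] G : exists p : set X * set X,
    open G /\ infinite_set G ->
    [/\ open p.1, p.1 !=set0, p.1 `<=` G &
      [/\ open p.2, infinite_set p.2, p.2 `<=` G & p.1 `&` p.2 = set0]].
  have [[Go Ginf]|] := pselect (open G /\ infinite_set G);
    last by exists (G, G).
  by have [U [G' UG]] := hausdorff_open_split T2 Go Ginf; exists (U, G').
pose G n := iter n (snd \o step) setT.
have GP n : open (G n) /\ infinite_set (G n).
  elim: n => [|n /stepP[_ _ _ []]//]; split=> //; exact: openT.
have Gsub m n : (m <= n)%N -> G n `<=` G m.
  elim: n => [|n IH]; first by rewrite leqn0 => /eqP ->.
  rewrite leq_eqVlt => /predU1P[->//|/IH].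
  by apply: subset_trans; have [_ _ _ []] := stepP _ (GP n).
exists (fun n => (step (G n)).1); split=> [n|n|m n mn].
- by have [] := stepP _ (GP n).
- by have [] := stepP _ (GP n).
- have [_ _ _ [_ _ _ disj]] := stepP _ (GP m).
  have [_ _ sub _] := stepP _ (GP n).
  apply/seteqP; split=> // z [mz /sub/(Gsub _ _ mn) nz].
  by rewrite -disj.
Qed.

Lemma card_open_ge (X : topologicalType) :
  hausdorff_space X -> infinite_set [set: X] ->
  [set: set nat] #<= [set U : set X | open U].
Proof.
move=> T2 /(infinite_hausdorff_disjoint_opens T2)[O [Oo O0 Odisj]].
apply: (@card_le_rel _ _ _ _ (fun S U => U = \bigcup_(n in S) O n)).
  by move=> S _; exists (\bigcup_(n in S) O n) => //; exact: bigcup_open.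
have sub S S' : \bigcup_(n in S) O n = \bigcup_(n in S') O n -> S `<=` S'.
  move=> E n Sn; have [z Onz] := O0 n.
  have [m S'm Omz] : (\bigcup_(n in S') O n) z by rewrite -E; exists n.
  have [mn|nm|<-//] := ltngtP m n.
    by have : (O m `&` O n) z by []; rewrite Odisj.
  by have : (O n `&` O m) z by []; rewrite Odisj.
by move=> S S' U _ _ -> E; apply/seteqP; split; exact: sub.
Qed.

Theorem mainTheorem4
    (d : Order.disp_t) (C : orderType d)
    (hC : is_continuum C)
    (hweak : weak_power_eq C C)
    (hstar : coloring_property C)
    (X : topologicalType)
    (hX : countable_spread X) :
  (hausdorff_space X -> [set: X] #<= [set: C]) /\
  (hausdorff_space X -> infinite_set [set: X] -> regular_space X ->
     [set U : set X | open U] #= [set: C]).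
Proof.
split; first exact: hausdorff_card.
move=> T2 Xinf reg; rewrite card_eq_le; apply/andP; split.
  exact: card_open_le.
apply: card_le_trans (card_open_ge T2 Xinf).
by have := continuum_powerset hC; rewrite card_eq_le => /andP[].
Qed.
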